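(* Let $F$ be a Bishop topology on $X$ and let $C \subseteq X$ be closed in $X$. Then the $F$-complement $$X \setminus_F C := \{x \in X \mid \exists_{f \in F}\big(f(x) > 0 \text{ and } \forall_{c \in C}(f(c) = 0)\big)\}$$ of $C$ in $X$ is the largest open set included in the set-theoretic complement $X \setminus C$; that is, $X \setminus_F C$ is open, $X \setminus_F C \subseteq X \setminus C$, and every open set $O \subseteq X$ with $O \subseteq X \setminus C$ satisfies $O \subseteq X \setminus_F C$.
   Context: The setting is Bishop-style constructive mathematics (BISH: intuitionistic logic, every set $X$ carries a given equality $=_X$, no countable choice). $\mathbb{F}(X)$ is the set of functions $X \to \mathbb{R}$ with pointwise equality. $\mathrm{Bic}(\mathbb{R})$ is the set of functions $\phi : \mathbb{R} \to \mathbb{R}$ that are uniformly continuous on every interval $[-n,n]$, $n \geq 1$. A Bishop space is a pair $(X,F)$, where $X$ is an inhabited set and $F \subseteq \mathbb{F}(X)$ is extensional (if $f \in F$ and $g$ is pointwise equal to $f$, then $g \in F$) such that: (BS1) all constant functions are in $F$; (BS2) $f, g \in F$ implies $f+g \in F$; (BS3) $f \in F$ and $\phi \in \mathrm{Bic}(\mathbb{R})$ imply $\phi \circ f \in F$; (BS4) if $f \in \mathbb{F}(X)$ and for every $\varepsilon > 0$ there is $g \in F$ with $|g(x) - f(x)| \leq \varepsilon$ for all $x \in X$, then $f \in F$. Then $F$ is called a Bishop topology on $X$. For $f \in F$ let $U(f) := \{x \in X \mid f(x) > 0\}$. A subset $O \subseteq X$ is open if for every $x \in O$ there is $f \in F$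 with $f(x) > 0$ and $U(f) \subseteq O$. For $C \subseteq X$, the closure $\overline{C}$ consists of all $x \in X$ such that for every $f \in F$, if $f(x) > 0$ then there is $c \in C$ with $f(c) > 0$; $C$ is closed if $\overline{C} \subseteq C$. The set $X \setminus C$ is $\{x \in X \mid \neg(x \in C)\}$. *)

(* Defs.v *)
From Stdlib Require Export QArith SetoidClass ConstructiveReals ConstructiveAbs.

Set Implicit Arguments.

Open Scope ConstructiveReals.

(* A set in Bishop's sense is a type with an equivalence relation; functions
   and subsets are required to respect the given equalities. *)

Record setoid_map (X Y : Type) {SX : Setoid X} {SY : Setoid Y} := SetoidMap {
  map_fun :> X -> Y;
  map_proper : Proper (equiv ==> equiv) map_fun
}.

Record subset (X : Type) {SX : Setoid X} := Subset {
  mem :> X -> Prop;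
  mem_proper : Proper (equiv ==> iff) mem
}.

Arguments setoid_map X Y {SX SY}.
Arguments SetoidMap {X Y SX SY} map_fun map_proper.
Arguments subset X {SX}.
Arguments Subset {X SX} mem mem_proper.

#[export] Existing Instance map_proper.
#[export] Existing Instance mem_proper.

Definition included {X : Type} {SX : Setoid X} (A B : subset X) : Prop :=
  forall x : X, A x -> B x.

#[export] Instance map_setoid (X Y : Type) (SX : Setoid X) (SY : Setoid Y) :
  Setoid (setoid_map X Y).
Proof.
  exists (fun f g : setoid_map X Y => forall x : X, equiv (f x) (g x)).
  split.
  - intros f x; reflexivity.
  - intros f g H x; symmetry; apply H.
  - intros f g h H1 H2 x; transitivity (g x); [apply H1 | apply H2].
Defined.

#[export] Instance CR_setoid (R : ConstructiveReals) : Setoid (CRcarrier R) :=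
  { equiv := CReq R; setoid_equiv := @CReq_rel R }.

Section RealFunctions.

Context {R : ConstructiveReals}.

(* The order [CRlt] lives in [Set]; its propositional truncation [CRltProp],
   which is equivalent to it, is used so that sets are given by [Prop]s. *)
#[export] Instance CRltProp_proper :
  Proper (CReq R ==> CReq R ==> iff) (CRltProp R).
Proof.
  assert (H : forall x x' y y' : CRcarrier R,
             CReq R x x' -> CReq R y y' -> CRltProp R x y -> CRltProp R x' y').
  { intros x x' y y' [Hx _] [_ Hy] H.
    apply CRltForget.
    apply (CRle_lt_trans _ x); [assumption |].
    apply (CRlt_le_trans _ y); [| assumption].
    apply CRltEpsilon; exact H. }
  intros x x' Hx y y' Hy; split; apply H; auto; symmetry; assumption.
Qed.

Definition in_interval (n : nat) (x : CRcarrier R) : Prop :=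
  let b := CR_of_Q R (inject_Z (Z.of_nat n)) in - b <= x <= b.

Definition Bic (phi : setoid_map (CRcarrier R) (CRcarrier R)) : Prop :=
  forall n : nat, (1 <= n)%nat ->
  forall eps : CRcarrier R, CRltProp R 0 eps ->
  exists delta : CRcarrier R, CRltProp R 0 delta /\
    forall x y : CRcarrier R, in_interval n x -> in_interval n y ->
      CRabs R (x - y) <= delta -> CRabs R (phi x - phi y) <= eps.

Context {X : Type} {SX : Setoid X}.

Local Notation FX := (setoid_map X (CRcarrier R)).

Definition const_map (a : CRcarrier R) : FX.
Proof.
  refine (SetoidMap (fun _ => a) _).
  intros x y _; reflexivity.
Defined.

Definition add_map (f g : FX) : FX.
Proof.
  refine (SetoidMap (fun x => f x + g x) _).
  intros x y H; exact (CRplus_morph_T _ _ (map_proper f _ _ H) _ _ (map_proper g _ _ H)).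
Defined.

Definition comp_map (phi : setoid_map (CRcarrier R) (CRcarrier R))
  (f : FX) : FX.
Proof.
  refine (SetoidMap (fun x => phi (f x)) _).
  intros x y H; exact (map_proper phi _ _ (map_proper f _ _ H)).
Defined.

(* Extensionality of [F] is part of its being a [subset]. *)
Record bishop_topology (F : subset FX) : Prop := {
  bs_inhabited : inhabited X;
  bs_const : forall a : CRcarrier R, F (const_map a);
  bs_add : forall f g : FX, F f -> F g -> F (add_map f g);
  bs_comp : forall (f : FX) phi, F f -> Bic phi -> F (comp_map phi f);
  bs_lim : forall f : FX,
    (forall eps : CRcarrier R, CRltProp R 0 eps ->
       exists g : FX, F g /\ forall x : X, CRabs R (g x - f x) <= eps) ->
    F f
}.

Definition U (f : FX) : subset X.
Proof.
  refine (Subset (fun x => CRltProp R 0 (f x)) _).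
  intros x y H; apply CRltProp_proper; [reflexivity |].
  exact (map_proper f _ _ H).
Defined.

Definition set_complement (C : subset X) : subset X.
Proof.
  refine (Subset (fun x => ~ C x) _).
  intros x y H; rewrite (mem_proper C _ _ H); reflexivity.
Defined.

Section Topology.

Context (F : subset FX).

Definition is_open (O : subset X) : Prop :=
  forall x : X, O x -> exists f : FX, F f /\ CRltProp R 0 (f x) /\ included (U f) O.

Definition closure (C : subset X) : subset X.
Proof.
  refine (Subset (fun x => forall f : FX, F f -> CRltProp R 0 (f x) ->
                    exists c : X, C c /\ CRltProp R 0 (f c)) _).
  intros x y H; split; intros Hx f Ff Hf; apply (Hx f Ff);
    apply (mem_proper (U f) _ _ H); exact Hf.
Defined.

Definition is_closed (C : subset X) : Prop := included (closure C) C.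

Definition F_complement (C : subset X) : subset X.
Proof.
  refine (Subset (fun x => exists f : FX, F f /\ CRltProp R 0 (f x) /\
                    forall c : X, C c -> CReq R (f c) 0) _).
  intros x y H; split; intros (f & Ff & Hf & Hc); exists f;
    repeat split; try assumption; try apply (Hc _ H0);
    apply (mem_proper (U f) _ _ H); exact Hf.
Defined.

End Topology.

End RealFunctions.

(* Main.v *)
Require Import Defs.

(** A function [f] witnessing that a point lies in the [F]-complement of [C]
    witnesses the same for every point of [U f], and it cannot be both zero and
    positive at a point of [C]; this gives openness and disjointness from [C].

    For maximality, let [U f] be a neighbourhood of [x] that misses [C]. Then
    [f <= 0] on [C], but [f] need not vanish there. Its positive part does, and
    it remains positive at [x]. Up to the factor 2 the positive part is
    [f + |f|], which lies in [F] because the absolute value is in [Bic]. *)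

Definition abs_map (R : ConstructiveReals) :
  setoid_map (CRcarrier R) (CRcarrier R) :=
  SetoidMap (CRabs R) (@CRabs_morph_prop R).

(** The absolute value is 1-Lipschitz, so [eps] is its own modulus. *)
Lemma Bic_abs (R : ConstructiveReals) : Bic (abs_map R).
Proof.
  intros n _ eps Heps; exists eps; split; [exact Heps |].
  intros x y _ _ Hxy.
  exact (CRle_trans _ _ _ (CRabs_triang_inv2 x y) Hxy).
Qed.

Lemma not_CRltProp_le (R : ConstructiveReals) (x y : CRcarrier R) :
  ~ CRltProp R x y -> y <= x.
Proof.
  intros H Hlt; exact (H (CRltForget R x y Hlt)).
Qed.

Lemma add_abs_pos (R : ConstructiveReals) (a : CRcarrier R) :
  CRltProp R 0 a -> CRltProp R 0 (a + CRabs R a).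
Proof.
  intros Ha; apply CRltForget.
  apply (CRlt_le_trans _ a); [exact (CRltEpsilon R 0 a Ha) |].
  rewrite <- (CRplus_0_r a) at 1.
  apply CRplus_le_compat_l, CRabs_pos.
Qed.

Lemma add_abs_nonpos (R : ConstructiveReals) (a : CRcarrier R) :
  a <= 0 -> CReq R (a + CRabs R a) 0.
Proof.
  intros Ha; rewrite (CRabs_left a Ha); apply CRplus_opp_r.
Qed.

Theorem theorem3p2 (R : ConstructiveReals) (X : Type) (SX : Setoid X)
  (F : subset (setoid_map X (CRcarrier R))) (HF : bishop_topology F)
  (C : subset X) (HC : is_closed F C) :
  is_open F (F_complement F C) /\
  included (F_complement F C) (set_complement C) /\
  (forall O : subset X, is_open F O -> included O (set_complement C) ->
     included O (F_complement F C)).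
Proof.
  split; [| split].
  - intros x (f & Ff & Hfx & HfC); exists f; repeat split; trivial.
    intros y Hfy; exists f; auto.
  - intros x (f & _ & Hfx & HfC) HxC.
    destruct (HfC x HxC) as [_ Hle].
    exact (Hle (CRltEpsilon R _ _ Hfx)).
  - intros O HO HOC x Ox.
    destruct (HO x Ox) as (f & Ff & Hfx & HfO).
    exists (add_map f (comp_map (abs_map R) f)); split; [| split].
    + apply (bs_add HF); [exact Ff |].
      apply (bs_comp HF); [exact Ff | apply Bic_abs].
    + exact (add_abs_pos _ _ Hfx).
    + intros c Hc; apply add_abs_nonpos, not_CRltProp_le; intros Hfc.
      exact (HOC c (HfO c Hfc) Hc).
Qed.
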